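(* Let $p\ge 3$ be a prime, $k$ a positive integer, and $m$ an integer not divisible by $p$ with $1\le m\le p^k$. Then $$ L(m,p^k)=\begin{cases} 2 & \text{if } m\not\equiv \pm 1 \bmod p;\\ p^{\lfloor k/2\rfloor} & \text{if } m\equiv \pm 1 \bmod p^{\lceil k/2\rceil};\\ 2p^j & \text{if } m=\pm 1+p^j r \text{ with integers } j, r,\ 1\le j<k/2,\ p\nmid r. \end{cases} $$ Here each condition involving $\pm 1$ means that it holds for at least one choice of the sign (and $m\not\equiv\pm1 \bmod p$ means that $m$ is congruent to neither $1$ nor $-1$ modulo $p$).
   Context: For a positive integer $n$ and an integer $m$ with $\gcd(m,n)=1$, define $$ L(m,n)=\bigl|\{x\in\mathbb{Z} : 1\le x\le n,\ \gcd(x,n)=1,\ (x-m)(xm-1)\equiv 0 \bmod n\}\bigr|. $$ *)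

(* Defs.v *)
From mathcomp Require Import all_boot all_order all_algebra.

Set Implicit Arguments.
Unset Strict Implicit.
Unset Printing Implicit Defensive.

Import GRing.Theory Num.Theory.

Local Open Scope ring_scope.

(* The integers 1 <= x <= n are the nonzero elements of 'I_n.+1.  The number
   L(m, n) is meant for n > 0 and m coprime to n. *)
Definition L (m : int) (n : nat) : nat :=
  #|[set x : 'I_n.+1 | [&& (1 <= x)%N, coprime x n
       & ((x%:Z - m) * (x%:Z * m - 1) == 0 %[mod n%:Z])%Z]]|.

(* Main.v *)
Require Import Defs.
From mathcomp Require Import all_boot all_order all_algebra.
From mathcomp Require Import zify ring.

Set Implicit Arguments.
Unset Strict Implicit.
Unset Printing Implicit Defensive.

Import Order.TTheory GRing.Theory Num.Theory.

Local Open Scope ring_scope.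

(** Write [y = x - m] and [z = x * m - 1].  Since [z = m * y + (m ^+ 2 - 1)],
the only obstruction to [y] and [z] being divisible by the same power of [p]
is the valuation of [m ^+ 2 - 1], and [p ^ k] divides [y * z] exactly when
[p ^ i] divides [y] and [p ^ (k - i)] divides [z] for some [i <= k]
(lemmas [dvdz_pfactor_mul] and [dvdz_exp_mul]).

If [m ^+ 2 - 1] has valuation exactly [j] with [2 * j < k], an [i] strictly
between [j] and [k - j] is impossible, since it would make [p ^ j.+1] divide
both [y] and [z]; so the solutions form the two residue classes [x = m] and
[x = m^-1] modulo [p ^ (k - j)].  These are distinct because
[p ^ (k - j)] does not divide [m ^+ 2 - 1], and each has [p ^ j] elements
between [1] and [p ^ k] (lemma [L_exact_valuation]).  If instead
[p ^ uphalf k] divides [m ^+ 2 - 1], it divides [y] if and only if it divides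
[z], and the solutions form the single class of [m] modulo [p ^ uphalf k]
(lemma [L_high_valuation]).

The theorem follows by computing the valuation of
[m ^+ 2 - 1 = (m - 1) * (m + 1)]; its first case is the valuation [0] case.
That [p] is odd enters only in the third case, where it ensures that just one
of the two factors is divisible by [p]. *)

(** The class of [a] modulo [d] is parametrised by [i |-> r + d * i], where [r]
is the representative of [a] in the range from [1] to [d]. *)
Lemma card_residue_class (d q : nat) (a : int) : (0 < d)%N ->
  #|[set x : 'I_(d * q).+1 | (1 <= x)%N && (d%:Z %| x%:Z - a)%Z]| = q.
Proof.
move=> d_gt0.
have d_neq0 : d%:Z != 0 by rewrite eqz_nat -lt0n.
have [r [r_gt0 r_le ra]] : exists r : nat,
    [/\ (0 < r)%N, (r <= d)%N & (d%:Z %| r%:Z - a)%Z].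
  (* The shift by one represents the class of [0] by [d]. *)
  have m_ge0 := modz_ge0 (a - 1) d_neq0.
  have m_lt : ((a - 1) %% d%:Z)%Z < d%:Z by rewrite ltz_pmod.
  exists (`|((a - 1) %% d%:Z)%Z|.+1)%N; split=> //; first by lia.
  rewrite -addn1 PoszD gez0_abs //.
  have := divz_eq (a - 1) d%:Z.
  set u := ((a - 1) %/ d%:Z)%Z; set v := ((a - 1) %% d%:Z)%Z => e.
  have -> : v + 1 - a = - u * d%:Z.
    by rewrite -[a](subrK 1) e; ring.
  exact: dvdz_mull.
have bound (i : 'I_q) : (r + d * i < (d * q).+1)%N.
  rewrite ltnS (leq_trans (leq_add r_le (leqnn _))) //.
  by rewrite -mulnS leq_mul.
pose f (i : 'I_q) : 'I_(d * q).+1 := Ordinal (bound i).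
have f_inj : injective f.
  move=> i j /(congr1 val) /= /addnI /eqP.
  by rewrite eqn_pmul2l // => /eqP /val_inj.
rewrite -[RHS]card_ord -(card_imset predT f_inj); apply: eq_card => x.
rewrite inE; apply/andP/imsetP => [[x_gt0 xa]|[i _ ->]]; last first.
  rewrite /= addn_gt0 r_gt0; split=> //.
  have -> : (r + d * i)%N%:Z - a = (r%:Z - a) + d%:Z * i%:Z.
    by rewrite PoszD PoszM; ring.
  by rewrite rpredD // dvdz_mulr.
have /dvdzP [t et] : (d%:Z %| x%:Z - r%:Z)%Z.
  have -> : x%:Z - r%:Z = (x%:Z - a) - (r%:Z - a) by ring.
  by rewrite rpredB.
have x_le : (x <= d * q)%N by rewrite -ltnS.
have t_ge0 : 0 <= t.
  rewrite leNgt; apply/negP => t_lt0.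
  have : t * d%:Z <= - d%:Z by nia.
  by lia.
have t_lt : (`|t| < q)%N.
  rewrite ltnNge; apply/negP => q_le.
  have : q%:Z * d%:Z <= t * d%:Z by nia.
  by lia.
exists (Ordinal t_lt) => //; apply: val_inj => /=.
apply/eqP; rewrite -eqz_nat PoszD PoszM gez0_abs //.
by rewrite mulrC -et; apply/eqP; ring.
Qed.

(** The exponent [i] is the one for which [gcdn `|a| (p ^ k) = p ^ i]; this
choice also covers [a = 0]. *)
Lemma dvdz_pfactor_mul (p k : nat) (a b : int) : prime p ->
  ((p ^ k)%N%:Z %| a * b)%Z ->
  exists i, [/\ (i <= k)%N, ((p ^ i)%N%:Z %| a)%Z
              & ((p ^ (k - i))%N%:Z %| b)%Z].
Proof.
move=> p_pr; rewrite dvdzE abszM /= => pk_ab.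
have /(dvdn_pfactor _ _ p_pr) [i i_le ei] := dvdn_gcdr `|a| (p ^ k).
exists i; split=> //; rewrite dvdzE /=; first by rewrite -ei dvdn_gcdl.
have pi_gt0 : (0 < p ^ i)%N by rewrite expn_gt0 prime_gt0.
rewrite -(dvdn_pmul2l pi_gt0) -expnD subnKC // -ei muln_gcdl.
by rewrite dvdn_gcd pk_ab dvdn_mulr.
Qed.

Lemma dvdz_expW (p e f : nat) (a : int) : (e <= f)%N ->
  ((p ^ f)%N%:Z %| a)%Z -> ((p ^ e)%N%:Z %| a)%Z.
Proof. by move=> ef; apply: dvdz_trans; rewrite dvdzE /= dvdn_exp2l. Qed.

Lemma dvdz_exp_mul (p e f k : nat) (a b : int) : (k <= e + f)%N ->
  ((p ^ e)%N%:Z %| a)%Z -> ((p ^ f)%N%:Z %| b)%Z ->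
  ((p ^ k)%N%:Z %| a * b)%Z.
Proof.
by move=> kef pa pb; apply: (dvdz_expW kef); rewrite expnD PoszM dvdz_mul.
Qed.

Lemma prime_dvdzM (p : nat) (a b : int) : prime p ->
  (p%:Z %| a * b)%Z = (p%:Z %| a)%Z || (p%:Z %| b)%Z.
Proof. by move=> p_pr; rewrite !dvdzE abszM Euclid_dvdM. Qed.

Section PrimePower.

Variables (p k : nat) (m : int).
Hypotheses (p_pr : prime p) (k_gt0 : (0 < k)%N) (pNm : ~~ (p%:Z %| m)%Z).

Let coprime_pow_m e : coprimez (p ^ e)%N%:Z m.
Proof.
rewrite coprimezE /=; apply: coprimeXl.
by rewrite prime_coprime //; move: pNm; rewrite dvdzE.
Qed.

(** Any [e > 0] works because both [x = m] and [x * m = 1] modulo [p] force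
[x] to be a unit. *)
Let coprime_of_dvd (e x : nat) : (0 < e)%N ->
  ((p ^ e)%N%:Z %| x%:Z - m)%Z || ((p ^ e)%N%:Z %| x%:Z * m - 1)%Z ->
  coprime x (p ^ k).
Proof.
move=> e_gt0 H; rewrite coprime_sym coprime_pexpl // prime_coprime //.
apply/negP => p_x; have {}p_x : (p%:Z %| x%:Z)%Z by rewrite dvdzE.
case/orP: H => /(dvdz_expW e_gt0); rewrite expn1 => H.
  move/negP: pNm; apply.
  have := rpredB p_x H.
  by have -> : x%:Z - (x%:Z - m) = m by ring.
have : (p%:Z %| 1)%Z.
  have := rpredB (dvdz_mulr m p_x) H.
  by have -> : x%:Z * m - (x%:Z * m - 1) = 1 by ring.
by rewrite dvdzE /= dvdn1 => /eqP p1; move: p_pr; rewrite p1.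
Qed.

Let card_class (e : nat) (a : int) : (e <= k)%N ->
  #|[set x : 'I_(p ^ k).+1 | (1 <= x)%N && ((p ^ e)%N%:Z %| x%:Z - a)%Z]|
    = (p ^ (k - e))%N.
Proof.
move=> e_le; have := @card_residue_class (p ^ e) (p ^ (k - e)) a.
by rewrite -expnD (subnKC e_le); apply; rewrite expn_gt0 prime_gt0.
Qed.

(** Multiplying by the inverse [u] of [m] modulo [p ^ e] turns the condition
into [x = u]. *)
Let card_inverse_class (e : nat) : (e <= k)%N ->
  #|[set x : 'I_(p ^ k).+1 |
      (1 <= x)%N && ((p ^ e)%N%:Z %| x%:Z * m - 1)%Z]| = (p ^ (k - e))%N.
Proof.
move=> e_le; have /coprimezP [[v u] /= euv] := coprime_pow_m e.
rewrite -(card_class u e_le); apply: eq_card => x; rewrite !inE.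
congr (_ && _).
have -> : x%:Z * m - 1 = (x%:Z - u) * m - (p ^ e)%N%:Z * v.
  by rewrite -euv; ring.
rewrite (rpredBr _ (dvdz_mulr _ (dvdzz _))).
by rewrite Gauss_dvdzl.
Qed.

Let dvd_sqr_sub1 (d : int) (x : int) :
  (d %| x - m)%Z -> (d %| x * m - 1)%Z -> (d %| m ^+ 2 - 1)%Z.
Proof.
move=> dy dz.
have -> : m ^+ 2 - 1 = (x * m - 1) - m * (x - m) by ring.
by rewrite rpredB // dvdz_mull.
Qed.

Let dvd_inverse_of_dvd (d : int) (x : int) : (d %| m ^+ 2 - 1)%Z ->
  (d %| x - m)%Z -> (d %| x * m - 1)%Z.
Proof.
move=> dD dy.
have -> : x * m - 1 = m * (x - m) + (m ^+ 2 - 1) by ring.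
by rewrite rpredD // dvdz_mull.
Qed.

Let dvd_of_dvd_inverse (e : nat) (x : int) :
  ((p ^ e)%N%:Z %| m ^+ 2 - 1)%Z ->
  ((p ^ e)%N%:Z %| x * m - 1)%Z -> ((p ^ e)%N%:Z %| x - m)%Z.
Proof.
move=> dD dz; rewrite -(Gauss_dvdzl _ (coprime_pow_m e)).
have -> : (x - m) * m = (x * m - 1) - (m ^+ 2 - 1) by ring.
by rewrite rpredB.
Qed.

(** The two classes come from the extreme ways of sharing [k] factors of [p]
between [y = x - m] and [z = x * m - 1]: once one of them has [k - j] factors,
the other automatically has the remaining [j].  The hypothesis [2 * j < k] is
what keeps the two classes disjoint. *)
Lemma L_exact_valuation (j : nat) : (2 * j < k)%N ->
  ((p ^ j)%N%:Z %| m ^+ 2 - 1)%Z -> ~~ ((p ^ j.+1)%N%:Z %| m ^+ 2 - 1)%Z ->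
  L m (p ^ k) = (2 * p ^ j)%N.
Proof.
move=> jk pjD pjSND.
set A := [set x : 'I_(p ^ k).+1 |
  (1 <= x)%N && ((p ^ (k - j))%N%:Z %| x%:Z - m)%Z].
set B := [set x : 'I_(p ^ k).+1 |
  (1 <= x)%N && ((p ^ (k - j))%N%:Z %| x%:Z * m - 1)%Z].
have kj_gt : (j < k - j)%N by move: jk; clear; lia.
have j_le : (j <= k)%N by move: jk; clear; lia.
have AB0 : A :&: B = set0.
  apply/setP => x; rewrite !inE; apply/negP => /andP[/andP[_ xA] /andP[_ xB]].
  move/negP: pjSND; apply; apply: dvdz_expW kj_gt _.
  exact: dvd_sqr_sub1 xA xB.
transitivity #|A :|: B|; last first.
  rewrite cardsU AB0 cards0 subn0 card_class ?card_inverse_class ?leq_subr //.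
  by rewrite subKn // mul2n addnn.
apply: eq_card => x; rewrite !inE -andb_orr; congr (_ && _).
rewrite eqz_mod_dvd subr0; apply/andP/idP => [[_]|xAB].
  move=> /(dvdz_pfactor_mul p_pr) [i [i_le pi_y pki_z]].
  have [i_le_j|j_lt_i] := leqP i j.
    by apply/orP; right; apply: dvdz_expW (leq_sub2l k i_le_j) pki_z.
  (* Here [j < i]; the range [j < i < k - j] contradicts [pjSND]. *)
  have [kj_le_i|i_lt_kj] := leqP (k - j) i.
    by apply/orP; left; apply: dvdz_expW kj_le_i pi_y.
  case/negP: pjSND; apply: (@dvd_sqr_sub1 _ x%:Z).
    exact: dvdz_expW j_lt_i pi_y.
  by apply: dvdz_expW pki_z; rewrite ltn_subRL addnC -ltn_subRL.
split; first by apply: coprime_of_dvd xAB; apply: leq_ltn_trans kj_gt.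
have k_le : (k <= j + (k - j))%N by rewrite subnKC.
have {}kj_gt := ltnW kj_gt.
case/orP: xAB => [xA|xB].
  rewrite mulrC; apply: (dvdz_exp_mul k_le _ xA).
  exact: dvd_inverse_of_dvd pjD (dvdz_expW kj_gt xA).
apply: (dvdz_exp_mul k_le _ xB).
exact: dvd_of_dvd_inverse pjD (dvdz_expW kj_gt xB).
Qed.

(** However the [k] factors of [p] are shared between [x - m] and [x * m - 1],
one of the two receives at least [uphalf k] of them; then so does the other,
and this already suffices for the product. *)
Lemma L_high_valuation : ((p ^ uphalf k)%N%:Z %| m ^+ 2 - 1)%Z ->
  L m (p ^ k) = (p ^ k./2)%N.
Proof.
move=> pcD.
have k_le : (k <= uphalf k + uphalf k)%N by clear; lia.
have c_gt0 : (0 < uphalf k)%N by move: k_gt0; clear; lia.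
have c_le : (uphalf k <= k)%N by clear; lia.
have -> : (k./2 = k - uphalf k)%N by clear; lia.
rewrite -(card_class m c_le).
apply: eq_card => x; rewrite !inE; congr (_ && _).
rewrite eqz_mod_dvd subr0; apply/andP/idP => [[_]|xm].
  move=> /(dvdz_pfactor_mul p_pr) [i [i_le pi_y pki_z]].
  have [c_le_i|i_lt_c] := leqP (uphalf k) i.
    exact: dvdz_expW c_le_i pi_y.
  apply: dvd_of_dvd_inverse => //; apply: dvdz_expW pki_z.
  by move: i_lt_c i_le; clear; lia.
split; first by apply: (coprime_of_dvd c_gt0); rewrite xm.
exact: dvdz_exp_mul k_le xm (dvd_inverse_of_dvd pcD xm).
Qed.

End PrimePower.

Theorem theorem2 (p k : nat) (m : int) (hp3 : (3 <= p)%N) (hp : prime p)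
    (hk : (0 < k)%N) (hpm : ~~ (p%:Z %| m)%Z)
    (hm1 : 1 <= m) (hmk : m <= (p ^ k)%N%:Z) :
  [/\ (m <> 1 %[mod p%:Z])%Z /\ (m <> -1 %[mod p%:Z])%Z ->
        L m (p ^ k) = 2%N,
      (m = 1 %[mod (p ^ uphalf k)%N%:Z])%Z \/
      (m = -1 %[mod (p ^ uphalf k)%N%:Z])%Z ->
        L m (p ^ k) = (p ^ k./2)%N
    & forall (j : nat) (r : int),
        (1 <= j)%N -> (2 * j < k)%N -> ~~ (p%:Z %| r)%Z ->
        m = 1 + (p ^ j)%N%:Z * r \/ m = -1 + (p ^ j)%N%:Z * r ->
        L m (p ^ k) = (2 * p ^ j)%N].
Proof.
have sqrE : m ^+ 2 - 1 = (m - 1) * (m - -1) by ring.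
split=> [[/eqP m1 /eqP mN1]|H|j r j_gt0 jk pNr H].
- rewrite (@L_exact_valuation p k m hp hk hpm 0) //.
  rewrite expn1 sqrE prime_dvdzM // negb_or.
  by rewrite -!eqz_mod_dvd m1 mN1.
- apply: L_high_valuation => //; rewrite sqrE.
  case: H => /eqP; rewrite eqz_mod_dvd => H; first exact: dvdz_mulr.
  exact: dvdz_mull.
have pN2 : ~~ (p%:Z %| 2)%Z by rewrite dvdzE /= gtnNdvd.
have p_pj : (p%:Z %| (p ^ j)%N%:Z)%Z by rewrite dvdzE /= dvdn_exp.
(* One of [m - 1] and [m + 1] is [p ^ j * r]; the other is congruent to [2] or
[- 2] modulo [p], hence prime to [p]. *)
have [s [pNs sE]] : exists s : int,
    ~~ (p%:Z %| s)%Z /\ m ^+ 2 - 1 = (p ^ j)%N%:Z * s.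
  have pj_r : (p%:Z %| (p ^ j)%N%:Z * r)%Z by apply: dvdz_mulr.
  case: H => ->.
    exists (r * (2 + (p ^ j)%N%:Z * r)); split; last by ring.
    by rewrite prime_dvdzM // (negbTE pNr) (rpredDr _ pj_r).
  exists (r * ((p ^ j)%N%:Z * r - 2)); split; last by ring.
  by rewrite prime_dvdzM // (negbTE pNr) (rpredBl _ pj_r).
apply: L_exact_valuation => //; rewrite sE; first exact: dvdz_mulr.
by rewrite expnSr PoszM dvdz_mul2l // eqz_nat -lt0n expn_gt0 prime_gt0.
Qed.
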